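(* Let $(\omega,\Omega)$ be a regular almost-cosymplectic-contact structure on $M$ with dual pair $(E,\Lambda)$. A vector field $X$ on $M$ is an infinitesimal symmetry of $\Omega$, i.e. $L_X\Omega=0$, if and only if $X=X_{(\alpha,h)}$ for some function $h\in C^\infty(M)$ and some 1-form $\alpha$ with $$d\alpha=0,\qquad \alpha(E)=0.$$
   Context: $M$ is a smooth manifold of dimension $2n+1$; everything is smooth. A regular almost-cosymplectic-contact structure on $M$ is a pair $(\omega,\Omega)$ of a 1-form $\omega$ and a 2-form $\Omega$ with $d\Omega=0$ and $\omega\wedge\Omega^n$ nowhere zero. Write $\Omega^\flat:TM\to T^*M$, $Y\mapsto Y^\flat=i_Y\Omega$, and for a bivector field $\Lambda$ write $\Lambda^\sharp:T^*M\to TM$, $\alpha\mapsto\alpha^\sharp=i_\alpha\Lambda$, i.e. $\beta(\alpha^\sharp)=\Lambda(\alpha,\beta)$. The dual pair $(E,\Lambda)$ is the unique pair of a vector field $E$ (the Reeb vector field) and a bivector field $\Lambda$ such that $(\Omega^\flat|_{\mathrm{Im}\,\Lambda^\sharp})^{-1}=\Lambda^\sharp|_{\mathrm{Im}\,\Omega^\flat}$, $i_E\omega=1$, $i_E\Omega=0$, $i_\omega\Lambda=0$. For a 1-form $\alpha$ and a function $h$ put $X_{(\alpha,h)}=\alpha^\sharp+hE$. Every vector field is of this form, with $h=\omega(X)$ and $\alpha$ determined up to adding a function multiple of $\omega$. $L$ denotes the Lie derivative. *)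

(* Defs.v *)
From HB Require Import structures.
From mathcomp Require Import all_boot all_order all_algebra all_fingroup.
From mathcomp Require Import all_classical all_reals all_analysis.

Set Implicit Arguments.
Unset Strict Implicit.
Unset Printing Implicit Defensive.

Import Order.TTheory GRing.Theory Num.Theory.
Import numFieldNormedType.Exports.

Local Open Scope classical_set_scope.
Local Open Scope ring_scope.

Section smooth_on.
Context {R : realType} {m : nat}.
Implicit Types (U : set 'rV[R]_m).

(* To be used on open sets U only: the derivatives are two-sided. *)
Fixpoint Ck_on (k : nat) U (f : 'rV[R]_m -> R) : Prop :=
  match k with
  | 0 => forall x, U x -> {for x, continuous f}
  | k'.+1 => (forall x, U x -> differentiable f x) /\
             (forall v, Ck_on k' U (fun x => 'D_v f x))
  end.

Definition smooth_on U (f : 'rV[R]_m -> R) : Prop := forall k, Ck_on k U f.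

Definition smooth_map_on l U (f : 'rV[R]_m -> 'rV[R]_l) : Prop :=
  forall j, smooth_on U (fun x => f x ord0 j).

End smooth_on.

(* A smooth manifold of dimension m, presented by a smooth atlas.  [chart i] and
   [chart_inv i] are only meaningful on [chart_dom i] and on its image.  The
   function [chart_at] selects a chart around each point; besides expressing
   that the charts cover the manifold, it fixes the model of tangent spaces
   explained below. *)
Record manifold (R : realType) (m : nat) := Manifold {
  carrier :> topologicalType;
  carrier_hausdorff : hausdorff_space carrier;
  carrier_second_countable : @second_countable carrier;
  chart_index : Type;
  chart_dom : chart_index -> set carrier;
  chart : chart_index -> carrier -> 'rV[R]_m;
  chart_inv : chart_index -> 'rV[R]_m -> carrier;
  chart_dom_open : forall i, open (chart_dom i);
  chart_im_open : forall i, open (chart i @` chart_dom i);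
  chartK : forall i p, chart_dom i p -> chart_inv i (chart i p) = p;
  chart_continuous : forall i, {within chart_dom i, continuous (chart i)};
  chart_inv_continuous : forall i,
    {within chart i @` chart_dom i, continuous (chart_inv i)};
  transition_smooth : forall i j,
    smooth_map_on (chart i @` (chart_dom i `&` chart_dom j))
      (chart j \o chart_inv i);
  chart_at : carrier -> chart_index;
  chart_at_dom : forall p, chart_dom (chart_at p) p
}.

Section tensor_fields.
Context {R : realType} {m : nat} (M : manifold R m).

(* The tangent space at p is 'rV[R]_m: a tangent vector is given by its
   coordinates in the chart [chart_at p].  The cotangent space at p is 'cV[R]_m,
   in the dual coordinates, with pairing [pairing].  A k-tuple of tangent vectors is
   the tuple of rows of a k x m matrix, so that changes of coordinates act on it
   by right multiplication.  The declarations below are fields of such objects,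
   without smoothness. *)
Definition vfield := M -> 'rV[R]_m.
Definition covfield := M -> 'cV[R]_m.
Definition kform (k : nat) := M -> 'M[R]_(k, m) -> R.
Definition bivfield := M -> 'cV[R]_m -> 'cV[R]_m -> R.

Definition pairing (a : 'cV[R]_m) (v : 'rV[R]_m) : R := (v *m a) ord0 ord0.

Definition form1 (a : covfield) : kform 1 := fun p v => pairing (a p) v.

(* v *m coord_change i j p = coordinates in the chart j of the tangent vector at
   p with coordinates v in the chart i *)
Definition coord_change (i j : chart_index M) (p : M) : 'M[R]_m :=
  jacobian (chart j \o chart_inv i) (chart i p).

Definition chart_im (i : chart_index M) : set 'rV[R]_m :=
  @chart _ _ M i @` chart_dom i.

(* The expressions of fields in the chart i, as functions of y in [chart_im i]. *)
Definition loc_vfield (X : vfield) i (y : 'rV[R]_m) : 'rV[R]_m :=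
  let p := chart_inv i y in X p *m coord_change (chart_at p) i p.

Definition loc_form k (w : kform k) i (y : 'rV[R]_m) (v : 'M[R]_(k, m)) : R :=
  let p := chart_inv i y in w p (v *m coord_change i (chart_at p) p).

Definition loc_biv (L : bivfield) i (y : 'rV[R]_m) (a b : 'cV[R]_m) : R :=
  let p := chart_inv i y in
  let C := coord_change (chart_at p) i p in L p (C *m a) (C *m b).

Definition smooth_fun (h : M -> R) : Prop :=
  forall i, smooth_on (chart_im i) (h \o chart_inv i).

Definition smooth_vfield (X : vfield) : Prop :=
  forall i, smooth_map_on (chart_im i) (loc_vfield X i).

Definition multilinear_rows k (f : 'M[R]_(k, m) -> R) : Prop :=
  forall (A B C : 'M[R]_(k, m)) (i : 'I_k) (b c : R),
    row i A = b *: row i B + c *: row i C ->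
    row' i B = row' i A -> row' i C = row' i A ->
    f A = b * f B + c * f C.

Definition alternating_rows k (f : 'M[R]_(k, m) -> R) : Prop :=
  forall (A : 'M[R]_(k, m)) (i j : 'I_k), i != j -> row i A = row j A -> f A = 0.

Definition smooth_form k (w : kform k) : Prop :=
  [/\ forall p, multilinear_rows (w p),
      forall p, alternating_rows (w p) &
      forall i v, smooth_on (chart_im i) (fun y => loc_form w i y v)].

Definition smooth_1form (a : covfield) : Prop := smooth_form (form1 a).

Definition smooth_bivector (L : bivfield) : Prop :=
  [/\ forall p c a a' b, L p (c *: a + a') b = c * L p a b + L p a' b,
      forall p c a b b', L p a (c *: b + b') = c * L p a b + L p a b',
      forall p a, L p a a = 0 &
      forall i a b, smooth_on (chart_im i) (fun y => loc_biv L i y a b)].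

(* (a /\ b)(v_1, ..., v_(k+l)) = 1 / (k! l!) sum_s sgn(s)
     a(v_s(1), ..., v_s(k)) b(v_s(k+1), ..., v_s(k+l)) *)
Definition wedge k l (a : kform k) (b : kform l) : kform (k + l) := fun p v =>
  (k`! * l`!)%:R^-1 * \sum_(s : 'S_(k + l))
    (-1) ^+ s * a p (usubmx (row_perm s v)) * b p (dsubmx (row_perm s v)).

Fixpoint wedge_pow (w : kform 2) (n : nat) : kform (n * 2) :=
  match n with
  | 0 => fun _ _ => 1
  | n'.+1 => wedge w (@wedge_pow w n')
  end.

Arguments wedge_pow w n : clear implicits.

(* The value at p of the exterior derivative and of the Lie derivative, computed
   in the chart [chart_at p]; in that chart the v_i are extended to vector fields
   with constant coordinates, which commute, so that the bracket terms disappear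
   from
     dw(v_0, ..., v_k) = sum_i (-1)^i v_i (w(.., v_i omitted, ..)) + brackets,
   and [X, v_i] = - D_(v_i) X in
     (L_X w)(v_1, ..., v_k) = X (w(v_1, ..., v_k))
                              - sum_i w(v_1, ..., [X, v_i], ..., v_k). *)
Definition ext_deriv k (w : kform k) : kform k.+1 := fun p v =>
  let c := chart_at p in
  \sum_(i < k.+1) (-1) ^+ i *
    'D_(row i v) (fun y => loc_form w c y (row' i v)) (chart c p).

Definition replace_row k (v : 'M[R]_(k, m)) (i : 'I_k) (u : 'rV[R]_m) :
    'M[R]_(k, m) :=
  \matrix_(a, b) (if a == i then u ord0 b else v a b).

Definition lie_deriv k (X : vfield) (w : kform k) : kform k := fun p v =>
  let c := chart_at p in
  let x := chart c p in
  'D_(X p) (fun y => loc_form w c y v) x +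
  \sum_(i < k) w p (replace_row v i ('D_(row i v) (loc_vfield X c) x)).

(* The covector i_v w and the vector i_a L at a point; see flatE and sharpE. *)
Definition flat (w : kform 2) (p : M) (v : 'rV[R]_m) : 'cV[R]_m :=
  \col_i w p (col_mx v (delta_mx 0 i)).

Definition sharp (L : bivfield) (p : M) (a : 'cV[R]_m) : 'rV[R]_m :=
  \row_i L p a (delta_mx i 0).

Lemma flatE (w : kform 2) p (u v : 'rV[R]_m) : multilinear_rows (w p) ->
  pairing (flat w p v) u = w p (col_mx v u).
Proof.
move=> wml.
have row'1 (x y : 'rV[R]_m) :
    row' (rshift 1 ord0 : 'I_(1 + 1)) (col_mx v x) =
    row' (rshift 1 ord0 : 'I_(1 + 1)) (col_mx v y).
  apply/matrixP => i j; rewrite !mxE.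
  case: splitP => // k; rewrite /= /bump; case: i => [] [|i] //=.
have lin b c (x y : 'rV[R]_m) : w p (col_mx v (b *: x + c *: y)) =
    b * w p (col_mx v x) + c * w p (col_mx v y).
  apply: (wml _ _ _ (rshift 1 ord0)) => //.
  by apply/rowP => j; rewrite !mxE; case: splitP => k /=; rewrite ord1 // !mxE.
have w0 : w p (col_mx v 0) = 0.
  by have := lin 0 0 0 0; rewrite !scale0r addr0 !mul0r addr0.
rewrite [in RHS](row_sum_delta u) /pairing mxE.
transitivity (\sum_i u 0 i * w p (col_mx v (delta_mx 0 i))).
  by apply: eq_bigr => i _; rewrite mxE.
elim/big_rec2 : _ => [//|i x y _ ->].
by have := lin (u 0 i) 1 (delta_mx 0 i) x; rewrite scale1r mul1r.
Qed.

Lemma sharpE (L : bivfield) p (a b : 'cV[R]_m) : smooth_bivector L ->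
  pairing b (sharp L p a) = L p a b.
Proof.
move=> [_ lin _ _].
have L0 : L p a 0 = 0.
  by have /eqP := lin p 1 a 0 0; rewrite scaler0 addr0 mul1r -subr_eq0 opprD addNKr
    oppr_eq0 => /eqP.
have -> : b = \sum_i b i 0 *: delta_mx i 0.
  by rewrite [LHS]matrix_sum_delta; apply: eq_bigr => i _; rewrite big_ord1.
rewrite /pairing mulmx_sumr summxE.
elim/big_rec2 : _ => [//|i x y _ ->]; rewrite lin; congr (_ + _).
rewrite -scalemxAr mxE -colE !mxE; congr (_ * _).
Qed.

Definition nowhere_zero k (w : kform k) : Prop := forall p, exists v, w p v != 0.

Definition regular_acc (n : nat) (omega : covfield) (Omega : kform 2) : Prop :=
  [/\ smooth_1form omega, smooth_form Omega,
      forall p v, ext_deriv Omega p v = 0 &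
      nowhere_zero (wedge (form1 omega) (wedge_pow Omega n))].

(* The first two clauses on the images say that the restrictions
   Im(sharp) -> Im(flat) of flat and Im(flat) -> Im(sharp) of sharp are mutually
   inverse. *)
Definition dual_pair (omega : covfield) (Omega : kform 2)
    (E : vfield) (L : bivfield) : Prop :=
  (smooth_vfield E /\ smooth_bivector L) /\
  [/\ forall p v, range (sharp L p) v -> sharp L p (flat Omega p v) = v,
      forall p a, range (flat Omega p) a -> flat Omega p (sharp L p a) = a,
      forall p, pairing (omega p) (E p) = 1,
      forall p, flat Omega p (E p) = 0 &
      forall p, sharp L p (omega p) = 0].

Definition Xfield (E : vfield) (L : bivfield) (a : covfield) (h : M -> R) :
  vfield := fun p => sharp L p (a p) + h p *: E p.

End tensor_fields.

(* Main.v *)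
Require Import Defs.
From mathcomp Require Import all_boot all_order all_algebra all_fingroup.
From mathcomp Require Import all_classical all_reals all_analysis.
From mathcomp Require Import ring lra.

Set Implicit Arguments.
Unset Strict Implicit.
Unset Printing Implicit Defensive.

Import Order.TTheory GRing.Theory Num.Theory.
Import numFieldNormedType.Exports.

Local Open Scope classical_set_scope.
Local Open Scope ring_scope.

(** The Cartan formula reduces the theorem to algebra at each point. Since Omega is
closed, L_X Omega = d (i_X Omega) for every vector field X
([ext_deriv_interior_product]). So X is a symmetry if and only if the 1-form
i_X Omega is closed, and it remains to see that i_X Omega is the alpha of the
statement.

Regularity says that no nonzero vector is killed by both omega and Omega
([regular_ker_trivial]): such a vector would annihilate the top-degree form
omega /\ Omega^n. This gives the decomposition X = (i_X Omega)^sharp + omega(X) E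
([dual_pair_decomp]), because the difference of the two sides is killed by omega
and Omega. So if L_X Omega = 0, then h = omega(X) and alpha = i_X Omega are as
required; they are smooth, being contractions of smooth tensor fields, and
alpha(E) = - (i_E Omega)(X) = 0. Conversely, if X = alpha^sharp + h E with
alpha(E) = 0, then i_X Omega = flat (alpha^sharp) = alpha
([flat_sharp_annihilator]), which is closed.

Exterior and Lie derivatives at p are computed in the chart selected at p, whereas
fields are represented at each point by their coordinates in the chart selected
at that point. The results on coordinate changes serve to express i_X Omega near p
through the local expressions of X and Omega, and the results on smooth functions
to differentiate these expressions. *)

(** * Smooth functions on an open set *)

(** Differentiability is a condition on the chosen linear map ['d g x], about
which nothing is known for [g]; so the expansion of [f] is first transferred to
[g], and uniqueness of the differential then identifies ['d g x]. *)
Lemma near_eq_differentiable {R : realType} {V W : normedModType R}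
    (f g : V -> W) (x : V) :
  (\forall y \near x, f y = g y) -> differentiable f x -> differentiable g x.
Proof.
move=> fg df; have [cdf dfE] := (diff_locallyP _ _).1 df.
have gE : g \o shift x = cst (g x) + 'd f x +o_ (0 : V) id.
  apply/eqaddoP => e e0; move/eqaddoP : dfE => /(_ e e0) fe.
  have fg0 : \forall h \near (0 : V), f (h + x) = g (h + x).
    rewrite (near_shift x) /= sub0r; near do rewrite /= subrK.
    exact: fg.
  near=> h; rewrite /= !fctE /= -(nbhs_singleton fg).
  have <- : f (h + x) = g (h + x) by near: h; exact: fg0.
  by near: h; exact: fe.
have dgE := diff_unique cdf gE.
by apply/diff_locallyP; rewrite dgE; split.
Unshelve. all: by end_near. Qed.

Lemma differentiable_rV {R : realType} {V : normedModType R} {m : nat}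
    (f : V -> 'rV[R]_m) (x : V) :
  (forall j, differentiable (fun y => f y ord0 j) x) -> differentiable f x.
Proof.
move=> df.
rewrite (_ : f = \sum_(j < m) (fun y => f y ord0 j *: (delta_mx 0 j : 'rV[R]_m))).
  by apply: differentiable_sum => j; exact: differentiableZl.
by apply/funext => y; rewrite fct_sumE -row_sum_delta.
Qed.

Section smooth_functions.
Context {R : realType} {m : nat} (U : set 'rV[R]_m).
Implicit Types f g : 'rV[R]_m -> R.

Lemma Ck_on_pred k f : Ck_on k.+1 U f -> Ck_on k U f.
Proof.
elim: k f => [|k IH] f [df Df]; last by split=> // v; exact/IH/Df.
by move=> x Ux; apply/differentiable_continuous/df.
Qed.

Lemma Ck_on_cst k c : Ck_on k U (cst c).
Proof.
elim: k c => [|k IH] c; first by move=> x _; exact: cst_continuous.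
split=> [x _|v]; first exact: differentiable_cst.
rewrite (_ : (fun x => _) = cst 0)//.
by apply/funext => x; rewrite derive_cst.
Qed.

Hypothesis openU : open U.

(** Tensor fields are given by formulas that hold only on the image of a chart.
Openness of [U] makes equality on [U] a local equality at each of its points, so
that it passes to the derivatives of all orders. *)
Lemma Ck_on_congr k f g : {in U, f =1 g} -> Ck_on k U f -> Ck_on k U g.
Proof.
have nearU (f' g' : 'rV[R]_m -> R) x : {in U, f' =1 g'} -> U x ->
    \forall y \near x, f' y = g' y.
  move=> fg Ux; near=> y; apply: fg; rewrite inE.
  by near: y; exact: open_nbhs_nbhs.
elim: k f g => [|k IH] f g fg.
  move=> cf x Ux; have cfx : f y @[y --> x] --> f x := cf x Ux.
  suff : g y @[y --> x] --> g x by [].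
  rewrite -(fg x (mem_set Ux)); apply: cvg_trans cfx.
  exact: near_eq_cvg (nearU _ _ _ fg Ux).
move=> [df Df]; split=> [x Ux|v].
  exact: near_eq_differentiable (nearU _ _ _ fg Ux) (df _ Ux).
apply: IH (Df v) => x /[!inE] Ux; exact/near_eq_derive/nearU.
Unshelve. all: by end_near. Qed.

Lemma Ck_onD k f g : Ck_on k U f -> Ck_on k U g -> Ck_on k U (f \+ g).
Proof.
elim: k f g => [|k IH] f g.
  by move=> cf cg x Ux; apply: continuousD; [exact: cf|exact: cg].
move=> [df Df] [dg Dg]; split=> [x Ux|v].
  by apply: differentiableD; [exact: df|exact: dg].
apply: Ck_on_congr (IH _ _ (Df v) (Dg v)) => x /[!inE] Ux /=.
by rewrite -deriveD//; apply: diff_derivable; [exact: df|exact: dg].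
Qed.

Lemma Ck_onM k f g : Ck_on k U f -> Ck_on k U g -> Ck_on k U (f \* g).
Proof.
elim: k f g => [|k IH] f g.
  by move=> cf cg x Ux; apply: continuousM; [exact: cf|exact: cg].
move=> Cf Cg; have [[df Df] [dg Dg]] := (Cf, Cg); split=> [x Ux|v].
  by apply: differentiableM; [exact: df|exact: dg].
have := Ck_onD (IH _ _ (Ck_on_pred Cf) (Dg v)) (IH _ _ (Ck_on_pred Cg) (Df v)).
apply: Ck_on_congr => x /[!inE] Ux /=.
by have /= -> := deriveM (diff_derivable (v := v) (df _ Ux)) (diff_derivable (dg _ Ux)).
Qed.

(** This is the form that a contraction of two tensor fields takes in a chart. *)
Lemma smooth_on_sumM n (f g : 'I_n -> 'rV[R]_m -> R) :
  (forall i, smooth_on U (f i)) -> (forall i, smooth_on U (g i)) ->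
  smooth_on U (fun x => \sum_(i < n) f i x * g i x).
Proof.
move=> sf sg k; rewrite (_ : (fun x => _) = \sum_(i < n) (f i \* g i)); last first.
  by apply/funext => x; rewrite fct_sumE.
elim/big_ind : _ => [|a b|i _]; [exact: Ck_on_cst|exact: Ck_onD|].
by apply: Ck_onM; [exact: sf|exact: sg].
Qed.

End smooth_functions.

(** The order of the factors is reversed since matrices act on row vectors from
the right. *)
Lemma jacobian_comp {R : realType} {m n l : nat} (f : 'rV[R]_m -> 'rV[R]_n)
    (g : 'rV[R]_n -> 'rV[R]_l) (x : 'rV[R]_m) :
  differentiable f x -> differentiable g (f x) ->
  jacobian (g \o f) x = jacobian f x *m jacobian g (f x).
Proof.
move=> df dg; apply/row_matrixP => i.
rewrite !rowE mulmxA -!deriveEjacobian//; last exact: differentiable_comp.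
by rewrite !deriveE//; [rewrite diff_comp|exact: differentiable_comp].
Qed.

Lemma jacobian_near_id {R : realType} {m : nat} (f : 'rV[R]_m -> 'rV[R]_m)
    (x : 'rV[R]_m) :
  (\forall y \near x, f y = y) -> jacobian f x = 1%:M.
Proof.
move=> fid; have df : differentiable f x.
  apply: (@near_eq_differentiable _ _ _ id); last exact: ex_diff.
  by near do apply/esym.
apply/row_matrixP => i; rewrite !rowE mulmx1 -deriveEjacobian//.
by rewrite (near_eq_derive (g := id)) ?derive_id.
Unshelve. all: by end_near. Qed.

(** * Coordinate changes between charts *)

Section charts.
Context {R : realType} {m : nat} (M : manifold R m).
Implicit Types (i j : chart_index M) (p : M).

Lemma chart_im_chart i p : chart_dom i p -> chart_im i (chart i p).
Proof. by move=> ip; exists p. Qed.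

Lemma chart_inv_dom i y : chart_im i y -> chart_dom i (chart_inv i y).
Proof. by case=> p ip <-; rewrite chartK. Qed.

Lemma chart_invK i y : chart_im i y -> chart i (chart_inv i y) = y.
Proof. by case=> p ip <-; rewrite chartK. Qed.

Lemma near_chart_im i p : chart_dom i p -> \forall y \near chart i p, chart_im i y.
Proof.
move=> ip; apply: open_nbhs_nbhs; split; first exact: chart_im_open.
exact: chart_im_chart.
Qed.

(** Not an instance of [chart_im_open], which speaks of the whole chart domain:
the overlap is the preimage of [chart_dom j] under the continuous
[chart_inv i]. *)
Lemma near_chart_overlap i j p : chart_dom i p -> chart_dom j p ->
  \forall y \near chart i p, chart_dom j (chart_inv i y).
Proof.
move=> ip jp; have := @chart_inv_continuous _ _ M i.
rewrite continuous_open_subspace; last exact: chart_im_open.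
move=> /(_ (chart i p)); rewrite inE => /(_ (chart_im_chart ip)).
rewrite /continuous_at chartK// => /(_ (chart_dom j)); apply.
by apply: open_nbhs_nbhs; split; first exact: chart_dom_open.
Qed.

Lemma differentiable_transition i j p : chart_dom i p -> chart_dom j p ->
  differentiable (chart j \o chart_inv i) (chart i p).
Proof.
move=> ip jp; apply: differentiable_rV => k.
have [+ _] := @transition_smooth _ _ M i j k 1.
by apply; exists p.
Qed.

(** The two transition maps compose to the identity near [chart i p], because the
overlap of the two domains is open; then the chain rule applies. *)
Lemma coord_changeK i j p : chart_dom i p -> chart_dom j p ->
  coord_change i j p *m coord_change j i p = 1%:M.
Proof.
move=> ip jp; rewrite /coord_change.
have -> : chart j p = (chart j \o chart_inv i) (chart i p) by rewrite /= chartK.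
rewrite -jacobian_comp; first last.
- by rewrite /= chartK//; exact: differentiable_transition.
- exact: differentiable_transition.
apply: jacobian_near_id; near=> y => /=.
rewrite chartK; last by near: y; exact: near_chart_overlap.
by apply: chart_invK; near: y; exact: near_chart_im.
Unshelve. all: by end_near. Qed.

Lemma coord_change_id i p : chart_dom i p -> coord_change i i p = 1%:M.
Proof.
move=> ip; apply: jacobian_near_id; near=> y => /=.
by apply: chart_invK; near: y; exact: near_chart_im.
Unshelve. all: by end_near. Qed.

End charts.

(** * Multilinear alternating functions of rows *)

Section multilinear_functions.
Context {R : realType} {m : nat}.

(** For multilinear alternating [f], the condition that the interior product of
[f] with [u] is zero, stated for all slots so that no sign is involved. *)
Definition vanishes_at_row k (f : 'M[R]_(k, m) -> R) (u : 'rV[R]_m) : Prop :=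
  forall v i, row i v = u -> f v = 0.

Lemma row'_eqP k (A B : 'M[R]_(k, m)) i :
  row' i A = row' i B <-> forall j, j != i -> row j A = row j B.
Proof.
split=> [AB j|AB].
  case: (unliftP i j) => [j' ->|->]; last by rewrite eqxx.
  by move=> _; apply/rowP => l; have /matrixP/(_ j' l) := AB; rewrite !mxE.
apply/matrixP => j l; have ji : lift i j != i by rewrite eq_sym neq_lift.
have /rowP/(_ l) := AB _ ji.
by rewrite !mxE.
Qed.

Lemma row_replace_row k (v : 'M[R]_(k, m)) i u : row i (replace_row v i u) = u.
Proof. by apply/rowP => j; rewrite !mxE eqxx. Qed.

Lemma row_replace_row_neq k (v : 'M[R]_(k, m)) i j u : j != i ->
  row j (replace_row v i u) = row j v.
Proof. by move=> /negbTE ji; apply/rowP => l; rewrite !mxE ji. Qed.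

Lemma replace_row_id k (v : 'M[R]_(k, m)) i : replace_row v i (row i v) = v.
Proof. by apply/matrixP => j l; rewrite !mxE; case: eqP => // ->. Qed.

Lemma replace_rowD k (f : 'M[R]_(k, m) -> R) v i a b x y : multilinear_rows f ->
  f (replace_row v i (a *: x + b *: y)) =
  a * f (replace_row v i x) + b * f (replace_row v i y).
Proof.
move=> fml; apply: (fml _ _ _ i); first by rewrite !row_replace_row.
  by apply/row'_eqP => j ji; rewrite !row_replace_row_neq.
by apply/row'_eqP => j ji; rewrite !row_replace_row_neq.
Qed.

(** The [k.+1] rows of [v] and [u] live in a space of dimension [m <= k], so there
is a linear relation between them. As [u] is nonzero, some row [i] of [v] occurs
in it, hence is a combination of [u] and the other rows of [v]. By linearity in
row [i] it suffices to put [u] or another row of [v] in its place: the first gives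
zero by hypothesis, the second by alternation. *)
Lemma vanishes_at_row_eq0 k (f : 'M[R]_(k, m) -> R) (u : 'rV[R]_m) v :
  (m <= k)%N -> multilinear_rows f -> alternating_rows f -> u != 0 ->
  vanishes_at_row f u -> f v = 0.
Proof.
move=> mk fml falt u0 fu.
have : kermx (col_mx v u) != 0.
  rewrite kermx_eq0 /row_free; apply: contraTN (rank_leq_col (col_mx v u)).
  by move=> /eqP ->; rewrite -ltnNge addn1.
move=> /rowV0Pn[c /sub_kermxP ck c0].
move: ck; rewrite -(hsubmxK c) mul_row_col => ck.
have [i ci0] : exists i, lsubmx c 0 i != 0.
  apply/rV0Pn; apply: contra_neq c0 => c1; move: ck.
  rewrite c1 mul0mx add0r [rsubmx c]mx11_scalar mul_scalar_mx => /eqP.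
  rewrite scaler_eq0 (negbTE u0) orbF => /eqP c2.
  by rewrite -(hsubmxK c) c1 [rsubmx c]mx11_scalar c2 raddf0 row_mx0.
(* the vectors that make f vanish when put in row i form a subspace *)
pose Z w := f (replace_row v i w) = 0.
have ZD a b x y : Z x -> Z y -> Z (a *: x + b *: y).
  by rewrite /Z replace_rowD// => -> ->; rewrite !mulr0 addr0.
have Zu : Z u by apply: (fu _ i); exact: row_replace_row.
have Zrow j : j != i -> Z (row j v).
  move=> ji; apply: (falt _ i j); first by rewrite eq_sym.
  by rewrite row_replace_row row_replace_row_neq.
have Z0 : Z 0 by have := ZD 0 0 u u Zu Zu; rewrite !scale0r addr0.
have ZS : Z (\sum_(j | j != i) lsubmx c 0 j *: row j v).
  elim/big_ind : _ => // [x y Zx Zy|j ji].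
    by have := ZD 1 1 x y Zx Zy; rewrite !scale1r.
  by have := ZD (lsubmx c 0 j) 0 _ _ (Zrow j ji) Z0; rewrite scaler0 addr0.
rewrite -(replace_row_id v i).
suff -> : row i v = - (lsubmx c 0 i)^-1 *:
    (\sum_(j | j != i) lsubmx c 0 j *: row j v) +
    (- (lsubmx c 0 i)^-1 * rsubmx c 0 0) *: u by exact: ZD.
move: ck; rewrite mulmx_sum_row (bigD1 i)//= {1}[rsubmx c]mx11_scalar.
rewrite mul_scalar_mx -scalerA -scalerDr -addrA => /eqP.
rewrite addr_eq0 => /eqP civ.
by rewrite scaleNr -scalerN -civ scalerA mulVf// scale1r.
Qed.

End multilinear_functions.

(** * The wedge product at a point *)

Section wedge_product.
Context {R : realType} {m : nat} (M : manifold R m).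
Implicit Types p : M.

Lemma row_row_perm k (v : 'M[R]_(k, m)) (s : 'S_k) i :
  row i (row_perm s v) = row (s i) v.
Proof. by apply/rowP => j; rewrite !mxE. Qed.

(** In the summand of [s], row [i] of the argument is row [(s^-1) i] of the
permuted matrix, so it is an argument of exactly one of the two factors. *)
Lemma wedge_multilinear k l (a : kform M k) (b : kform M l) p :
  multilinear_rows (a p) -> multilinear_rows (b p) ->
  multilinear_rows (wedge a b p).
Proof.
move=> aml bml A B C i x y Ai /row'_eqP Bi /row'_eqP Ci.
rewrite /wedge mulrCA [y * _]mulrCA -mulrDr; congr (_ * _).
(* stated for variables, so that ring does not look into the matrices *)
have distrl e c d g : e * (x * c + y * d) * g = x * (e * c * g) + y * (e * d * g).
  by ring.
have distrr e c d g : e * g * (x * c + y * d) = x * (e * g * c) + y * (e * g * d).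
  by ring.
rewrite !mulr_sumr -big_split/=; apply: eq_bigr => s _.
have neq j : j != (s^-1)%g i -> s j != i.
  by apply: contra_neq => <-; rewrite permK.
have spl : s ((s^-1)%g i) = i by rewrite permKV.
move: neq spl; case: (split_ordP ((s^-1)%g i)) => j -> neq sj.
- have d (D : 'M[R]_(k + l, m)) : (forall r, r != i -> row r D = row r A) ->
      dsubmx (row_perm s D) = dsubmx (row_perm s A).
    move=> DA; apply/row_matrixP => r; rewrite !row_dsubmx !row_row_perm.
    by apply/DA/neq; rewrite eq_rlshift.
  rewrite (d B)// (d C)//.
  rewrite (aml (usubmx (row_perm s A)) (usubmx (row_perm s B))
               (usubmx (row_perm s C)) j x y).
  + exact: distrl.
  + by rewrite !row_usubmx !row_row_perm sj.
  + apply/row'_eqP => r rj; rewrite !row_usubmx !row_row_perm; apply/Bi/neq.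
    by rewrite eq_lshift.
  + apply/row'_eqP => r rj; rewrite !row_usubmx !row_row_perm; apply/Ci/neq.
    by rewrite eq_lshift.
- have d (D : 'M[R]_(k + l, m)) : (forall r, r != i -> row r D = row r A) ->
      usubmx (row_perm s D) = usubmx (row_perm s A).
    move=> DA; apply/row_matrixP => r; rewrite !row_usubmx !row_row_perm.
    by apply/DA/neq; rewrite eq_lrshift.
  rewrite (d B)// (d C)//.
  rewrite (bml (dsubmx (row_perm s A)) (dsubmx (row_perm s B))
               (dsubmx (row_perm s C)) j x y).
  + exact: distrr.
  + by rewrite !row_dsubmx !row_row_perm sj.
  + apply/row'_eqP => r rj; rewrite !row_dsubmx !row_row_perm; apply/Bi/neq.
    by rewrite eq_rshift.
  + apply/row'_eqP => r rj; rewrite !row_dsubmx !row_row_perm; apply/Ci/neq.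
    by rewrite eq_rshift.
Qed.

(** Composing [s] with the transposition of the two equal rows leaves the
arguments of [a] and [b] unchanged and reverses the sign, so the sum is its own
opposite. *)
Lemma wedge_alternating k l (a : kform M k) (b : kform M l) p :
  alternating_rows (wedge a b p).
Proof.
move=> v i j ij vij; rewrite /wedge; set S := \sum_s _.
suff SN : S = - S.
  have -> : S = 0 by lra.
  by rewrite mulr0.
rewrite {1}/S (reindex_inj (mulIg (tperm i j))) /= /S -sumrN.
apply: eq_bigr => s _.
have -> : row_perm (s * tperm i j) v = row_perm s v.
  apply/row_matrixP => r; rewrite !row_row_perm permM.
  by case: tpermP => [->|->|].
by rewrite odd_permM odd_tperm ij addbT signrN !mulNr.
Qed.

Lemma wedge_vanishes_at_row k l (a : kform M k) (b : kform M l) p u :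
  vanishes_at_row (a p) u -> vanishes_at_row (b p) u ->
  vanishes_at_row (wedge a b p) u.
Proof.
move=> au bu v i vi; rewrite /wedge big1 ?mulr0// => s _.
have spl : s ((s^-1)%g i) = i by rewrite permKV.
move: spl; case: (split_ordP ((s^-1)%g i)) => j -> sj.
- by rewrite (au _ j) ?mulr0 ?mul0r// row_usubmx row_row_perm sj.
- by rewrite (bu _ j) ?mulr0// row_dsubmx row_row_perm sj.
Qed.

Lemma wedge_pow_multilinear (w : kform M 2) n p : multilinear_rows (w p) ->
  multilinear_rows (@wedge_pow _ _ _ w n p).
Proof.
move=> wml; elim: n => [A B C [] //|n IH].
exact: (@wedge_multilinear 2 (n * 2) w (@wedge_pow _ _ _ w n) p).
Qed.

Lemma wedge_pow_vanishes_at_row (w : kform M 2) n p u :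
  vanishes_at_row (w p) u -> vanishes_at_row (@wedge_pow _ _ _ w n p) u.
Proof.
move=> wu; elim: n => [v [] //|n IH].
exact: (@wedge_vanishes_at_row 2 (n * 2) w (@wedge_pow _ _ _ w n) p).
Qed.

Lemma form1_multilinear (a : covfield M) p : multilinear_rows (form1 a p).
Proof.
move=> A B C i x y; rewrite ord1 => /rowP Ai _ _.
have rowid (D : 'M[R]_(1, m)) : row ord0 D = D.
  by apply/rowP => j; rewrite !mxE.
have -> : A = x *: B + y *: C by apply/rowP => j; have := Ai j; rewrite !mxE.
by rewrite /form1 /pairing mulmxDl -!scalemxAl !mxE.
Qed.

End wedge_product.

(** * Functions of two rows *)

Section two_rows.
Context {R : realType} {m : nat}.
Implicit Types u v w x y : 'rV[R]_m.

Lemma row_col_mx0 u v : row (0 : 'I_2) (col_mx u v) = u.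
Proof.
by apply/rowP => j; rewrite !mxE; case: splitP => // k _; rewrite ord1.
Qed.

Lemma row_col_mx1 u v : row (1 : 'I_2) (col_mx u v) = v.
Proof.
apply/rowP => j; rewrite !mxE; case: splitP => [[[]]//|k _].
by rewrite ord1.
Qed.

Lemma col_mx_rows (A : 'M[R]_(2, m)) : col_mx (row 0 A) (row 1 A) = A.
Proof.
apply/row_matrixP; case=> [[|[|//]] i].
  by rewrite (_ : Ordinal i = 0) ?row_col_mx0//; exact/val_inj.
by rewrite (_ : Ordinal i = 1) ?row_col_mx1//; exact/val_inj.
Qed.

Lemma row_row' k (A : 'M[R]_(k, m)) i j : row j (row' i A) = row (lift i j) A.
Proof. by apply/rowP => l; rewrite !mxE. Qed.

Lemma row'_col_mx0 u v : row' (0 : 'I_2) (col_mx u v) = v.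
Proof.
apply/row_matrixP => i; rewrite ord1 row_row' row_id.
by rewrite (_ : lift _ _ = 1) ?row_col_mx1//; exact/val_inj.
Qed.

Lemma row'_col_mx1 u v : row' (1 : 'I_2) (col_mx u v) = u.
Proof.
apply/row_matrixP => i; rewrite ord1 row_row' row_id.
by rewrite (_ : lift _ _ = 0) ?row_col_mx0//; exact/val_inj.
Qed.

Lemma replace_row_col_mx0 u v w : replace_row (col_mx u v) (0 : 'I_2) w = col_mx w v.
Proof.
rewrite -[LHS]col_mx_rows row_replace_row row_replace_row_neq//.
by rewrite row_col_mx1.
Qed.

Lemma replace_row_col_mx1 u v w : replace_row (col_mx u v) (1 : 'I_2) w = col_mx u w.
Proof.
rewrite -[LHS]col_mx_rows row_replace_row row_replace_row_neq//.
by rewrite row_col_mx0.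
Qed.

Section two_form.
Variable f : 'M[R]_(2, m) -> R.
Hypotheses (fml : multilinear_rows f) (falt : alternating_rows f).

Lemma form2_linl a b x y w :
  f (col_mx (a *: x + b *: y) w) = a * f (col_mx x w) + b * f (col_mx y w).
Proof.
have := replace_rowD (col_mx x w) 0 a b x y fml.
by rewrite !replace_row_col_mx0.
Qed.

Lemma form2_linr a b x y w :
  f (col_mx w (a *: x + b *: y)) = a * f (col_mx w x) + b * f (col_mx w y).
Proof.
have := replace_rowD (col_mx w x) 1 a b x y fml.
by rewrite !replace_row_col_mx1.
Qed.

Lemma form2_suml n (c : 'I_n -> R) (x : 'I_n -> 'rV[R]_m) w :
  f (col_mx (\sum_i c i *: x i) w) = \sum_i c i * f (col_mx (x i) w).
Proof.
elim/big_rec2 : _ => [|i r z _ <-].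
  by have := form2_linl 0 0 0 0 w; rewrite !scale0r addr0 !mul0r addr0.
by have := form2_linl (c i) 1 (x i) z w; rewrite scale1r mul1r.
Qed.

Lemma form2_diag u : f (col_mx u u) = 0.
Proof. by apply: (falt (i := 0) (j := 1)); rewrite // row_col_mx0 row_col_mx1. Qed.

Lemma form2_anti u v : f (col_mx v u) = - f (col_mx u v).
Proof.
have := form2_diag (1 *: u + 1 *: v).
rewrite form2_linl !form2_linr !form2_diag !mul1r add0r addr0 => /eqP.
by rewrite addrC addr_eq0 => /eqP.
Qed.

End two_form.

End two_rows.

(** * Pointwise algebra of a dual pair *)

Section contact_algebra.
Context {R : realType} {m : nat} (M : manifold R m).
Context (omega : covfield M) (Omega : kform M 2).
Implicit Types (p : M) (u v : 'rV[R]_m) (a b : 'cV[R]_m).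

Lemma flat_linear p c d u v : multilinear_rows (Omega p) ->
  flat Omega p (c *: u + d *: v) = c *: flat Omega p u + d *: flat Omega p v.
Proof. by move=> Oml; apply/colP => i; rewrite !mxE form2_linl. Qed.

Lemma pairing_linr a c d u v :
  pairing a (c *: u + d *: v) = c * pairing a u + d * pairing a v.
Proof. by rewrite /pairing mulmxDl -!scalemxAl !mxE. Qed.

Lemma flat_anti p u v : multilinear_rows (Omega p) -> alternating_rows (Omega p) ->
  pairing (flat Omega p u) v = - pairing (flat Omega p v) u.
Proof. by move=> Oml Oalt; rewrite !flatE// form2_anti. Qed.

Lemma pairing_inj a b : (forall v, pairing a v = pairing b v) -> a = b.
Proof.
move=> ab; apply/colP => i; have := ab (delta_mx 0 i).
by rewrite /pairing -!rowE !mxE.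
Qed.

(** Nondegeneracy: a vector [u] in both kernels is annihilated by [omega] and
[Omega], hence by every wedge product formed from them, and a form of degree at
least [m] that annihilates a nonzero vector is zero. *)
Lemma regular_ker_trivial n p u :
  multilinear_rows (Omega p) -> alternating_rows (Omega p) ->
  (exists A, wedge (form1 omega) (@wedge_pow _ _ _ Omega n) p A != 0) ->
  (m <= 1 + n * 2)%N ->
  flat Omega p u = 0 -> pairing (omega p) u = 0 -> u = 0.
Proof.
move=> Oml Oalt [B nz] mn uO uo; apply/eqP; apply: contraTT nz => u0.
rewrite negbK; apply/eqP/(vanishes_at_row_eq0 _ mn _ _ u0).
- by apply: wedge_multilinear; [exact: form1_multilinear|
                                exact: wedge_pow_multilinear].
- exact: wedge_alternating.
apply: wedge_vanishes_at_row.
  by move=> A i; rewrite ord1 row_id => ->.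
apply: wedge_pow_vanishes_at_row => A i Ai.
have Ou w : Omega p (col_mx u w) = 0.
  by rewrite -flatE// uO /pairing mulmx0 mxE.
rewrite -(col_mx_rows A).
have [i0|i1] : i = 0 \/ i = 1.
  by case: i {Ai} => [[|[|//]] i]; [left|right]; exact/val_inj.
- by rewrite -[X in col_mx (row X _)]i0 Ai.
- by rewrite -[X in col_mx _ (row X _)]i1 Ai form2_anti// Ou oppr0.
Qed.

Lemma bivector_anti (L : bivfield M) p a b : smooth_bivector L ->
  L p a b = - L p b a.
Proof.
case=> lin1 lin2 Lalt _; have := Lalt p (1 *: a + b).
by rewrite lin1 !lin2 !Lalt !mul1r add0r addr0 => /eqP; rewrite addr_eq0 => /eqP.
Qed.

Section dual.
Context (E : vfield M) (L : bivfield M).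
Hypothesis ker_trivial : forall p u,
  flat Omega p u = 0 -> pairing (omega p) u = 0 -> u = 0.
Hypothesis Oform : smooth_form Omega.
Hypothesis hdual : dual_pair omega Omega E L.

(** The difference [d] of the two sides lies in the kernel of [flat], since [flat]
inverts [sharp] on the image of [flat] and kills [E]. It also lies in the kernel
of [omega]: [omega] takes the value 1 on [E], and its value on
[sharp (flat u)] is, up to sign, that of [flat u] on [sharp omega = 0].
Nondegeneracy gives [d = 0]. *)
Lemma dual_pair_decomp p u :
  u = sharp L p (flat Omega p u) + pairing (omega p) u *: E p.
Proof.
have [Oml _ _] := Oform.
have [[_ Lbiv] [_ flatK oE OE sharpo]] := hdual.
set c := pairing _ u; set s := sharp _ _ _.
have uE : u - (s + c *: E p) = 1 *: (1 *: u + (-1) *: s) + (- c) *: E p.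
  by rewrite !scale1r scaleN1r scaleNr opprD addrA.
apply/subr0_eq; apply: (ker_trivial (p := p)); rewrite uE.
  rewrite !flat_linear// OE flatK; last by exists u.
  by rewrite !scale1r scaleN1r scaler0 addr0 subrr.
rewrite !pairing_linr oE (sharpE _ _ _ Lbiv) (bivector_anti _ _ _ Lbiv).
rewrite -(sharpE _ _ _ Lbiv) sharpo [pairing _ 0]/pairing mul0mx mxE -/c.
ring.
Qed.

(** The image of [flat] is the whole annihilator of [E]. Rather than by counting
dimensions, this follows by pairing [a] with the decomposition of [v]: the [E]
part contributes nothing, and moving [a] across the skew maps [sharp] and [flat]
turns [a (sharp (flat v))] into [flat (sharp a) v]. *)
Lemma flat_sharp_annihilator p a :
  pairing a (E p) = 0 -> flat Omega p (sharp L p a) = a.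
Proof.
move=> aE0; have [Oml Oalt _] := Oform; have [[_ Lbiv] _] := hdual.
apply: pairing_inj => v.
rewrite [in RHS](dual_pair_decomp p v).
rewrite -[X in pairing a (X + _)]scale1r pairing_linr aE0 mulr0 addr0 mul1r.
by rewrite flat_anti// !(sharpE _ _ _ Lbiv) -bivector_anti.
Qed.

End dual.
End contact_algebra.

(** * Tensor fields in a chart *)

Section local_expressions.
Context {R : realType} {m : nat} (M : manifold R m).
Implicit Types (i : chart_index M) (X : vfield M).

Definition interior_product X (w : kform M 2) : covfield M :=
  fun p => flat w p (X p).

Lemma loc_form_multilinear k (w : kform M k) i y :
  (forall p, multilinear_rows (w p)) -> multilinear_rows (loc_form w i y).
Proof.
move=> wml A B C r b c Ar /row'_eqP Br /row'_eqP Cr; apply: (wml _ _ _ _ r).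
- by rewrite !row_mul Ar mulmxDl -!scalemxAl.
- by apply/row'_eqP => s sr; rewrite !row_mul Br.
- by apply/row'_eqP => s sr; rewrite !row_mul Cr.
Qed.

(** The tangent space at [p] is modelled on the coordinates of [chart_at p], so in
that chart the local expressions at [p] are the tensors themselves. *)
Lemma loc_form_chart_at k (w : kform M k) p v :
  loc_form w (chart_at p) (chart (chart_at p) p) v = w p v.
Proof.
have pc := chart_at_dom p.
by rewrite /loc_form chartK// coord_change_id// mulmx1.
Qed.

Lemma loc_vfield_chart_at X p :
  loc_vfield X (chart_at p) (chart (chart_at p) p) = X p.
Proof.
have pc := chart_at_dom p.
by rewrite /loc_vfield chartK// coord_change_id// mulmx1.
Qed.

Lemma loc_vfieldK X i y : chart_im i y ->
  loc_vfield X i y *m coord_change i (chart_at (chart_inv i y)) (chart_inv i y) =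
  X (chart_inv i y).
Proof.
move=> iy; rewrite /loc_vfield -mulmxA coord_changeK ?mulmx1//.
  exact: chart_at_dom.
exact: chart_inv_dom.
Qed.

Lemma loc_contraction1 (a : covfield M) X i y : chart_im i y ->
  pairing (a (chart_inv i y)) (X (chart_inv i y)) =
  \sum_(j < m) loc_vfield X i y 0 j * loc_form (form1 a) i y (delta_mx 0 j : 'rV[R]_m).
Proof.
move=> iy; rewrite -(loc_vfieldK X iy) [in LHS](row_sum_delta (loc_vfield X i y)).
rewrite /pairing !mulmx_suml summxE; apply: eq_bigr => j _.
by rewrite -!scalemxAl mxE.
Qed.

Lemma loc_interior_product (w : kform M 2) X i y v :
  (forall p, multilinear_rows (w p)) -> chart_im i y ->
  loc_form (form1 (interior_product X w)) i y v =
  loc_form w i y (col_mx (loc_vfield X i y) v).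
Proof.
move=> wml iy; rewrite /loc_form /form1 /interior_product flatE//.
have mulE (x z : 'rV[R]_m) (C : 'M[R]_m) :
    (col_mx x z : 'M[R]_(2, m)) *m C = col_mx (x *m C) (z *m C).
  exact: (@mul_col_mx _ 1 1 _ _ x z C).
by rewrite mulE loc_vfieldK.
Qed.

Lemma loc_form2_sum (w : kform M 2) i y (u v : 'rV[R]_m) :
  (forall p, multilinear_rows (w p)) ->
  loc_form w i y (col_mx u v) =
  \sum_(j < m) u 0 j * loc_form w i y (col_mx (delta_mx 0 j : 'rV[R]_m) v).
Proof.
move=> wml; rewrite {1}(row_sum_delta u).
exact: (form2_suml (loc_form_multilinear i y wml)).
Qed.

Lemma smooth_pairing (a : covfield M) X : smooth_1form a -> smooth_vfield X ->
  smooth_fun (fun p => pairing (a p) (X p)).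
Proof.
move=> [_ _ sa] sX i k; have oi : open (chart_im i) by exact: chart_im_open.
apply: (Ck_on_congr oi) (smooth_on_sumM oi (sX i)
  (fun j => sa i (delta_mx 0 j : 'rV[R]_m)) k).
by move=> y /[!inE] iy; rewrite /= (loc_contraction1 _ _ iy).
Qed.

Lemma smooth_interior_product (w : kform M 2) X : smooth_form w ->
  smooth_vfield X -> smooth_1form (interior_product X w).
Proof.
move=> [wml _ sw] sX; split=> [p|p A i j|i v k].
- exact: form1_multilinear.
- by rewrite !ord1 eqxx.
have oi : open (chart_im i) by exact: chart_im_open.
apply: (Ck_on_congr oi) (smooth_on_sumM oi (sX i)
  (fun j => sw i (col_mx (delta_mx 0 j : 'rV[R]_m) v)) k).
by move=> y /[!inE] iy; rewrite loc_interior_product// loc_form2_sum.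
Qed.

(** * The Cartan formula for a closed 2-form *)

Lemma derive_sumM n (g h : 'I_n -> 'rV[R]_m -> R) x u :
  (forall j, derivable (g j) x u) -> (forall j, derivable (h j) x u) ->
  'D_u (fun y => \sum_(j < n) g j y * h j y) x =
  \sum_(j < n) (g j x * 'D_u (h j) x + h j x * 'D_u (g j) x).
Proof.
move=> dg dh.
have -> : (fun y => \sum_(j < n) g j y * h j y) = \sum_(j < n) (g j * h j).
  by apply/funext => y; rewrite fct_sumE.
rewrite derive_sum => [|j]; last exact: derivableM.
by apply: eq_bigr => j _; rewrite deriveM.
Qed.

(** Leibniz rule for [w(X, v)] with [v] constant: the first term freezes the
components of [X] at [x] and differentiates the coefficients of [w], the second
differentiates [X]. *)
Lemma derive_loc_form2 (w : kform M 2) X i x (u v : 'rV[R]_m) :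
  smooth_form w -> smooth_vfield X -> chart_im i x ->
  'D_u (fun y => loc_form w i y (col_mx (loc_vfield X i y) v)) x =
  'D_u (fun y => loc_form w i y (col_mx (loc_vfield X i x) v)) x +
  loc_form w i x (col_mx ('D_u (loc_vfield X i) x) v).
Proof.
move=> [wml _ sw] sX ix.
have dX j : derivable (fun y => loc_vfield X i y 0 j) x u.
  by have [dX _] := sX i j 1; exact/diff_derivable/dX.
have dw j : derivable (fun y => loc_form w i y (col_mx (delta_mx 0 j : 'rV[R]_m) v)) x u.
  have [dw _] := sw i (col_mx (delta_mx 0 j : 'rV[R]_m) v) 1; exact/diff_derivable/dw.
have dcst j : derivable (fun=> loc_vfield X i x 0 j) x u.
  exact: derivable_cst.
pose G j y := loc_form w i y (col_mx (delta_mx 0 j : 'rV[R]_m) v).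
have D (Y : 'rV[R]_m -> 'rV[R]_m) :
    (forall j, derivable (fun y => Y y 0 j) x u) ->
    'D_u (fun y => loc_form w i y (col_mx (Y y) v)) x =
    \sum_(j < m) (Y x 0 j * 'D_u (G j) x + G j x * 'D_u (fun y => Y y 0 j) x).
  move=> dY; rewrite -(derive_sumM dY dw); congr ('D_u _ x).
  by apply/funext => y; exact: loc_form2_sum.
(* D with a constant field, respectively the expansion of w in the basis *)
have frozen : 'D_u (fun y => loc_form w i y (col_mx (loc_vfield X i x) v)) x =
    \sum_(j < m) loc_vfield X i x 0 j * 'D_u (G j) x.
  etransitivity; first exact: (D (fun=> loc_vfield X i x) dcst).
  apply: eq_bigr => j _.
  by rewrite [X in _ + _ * X]derive_cst mulr0 addr0.
have moving : loc_form w i x (col_mx ('D_u (loc_vfield X i) x) v) =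
    \sum_(j < m) G j x * 'D_u (fun y => loc_vfield X i y 0 j) x.
  rewrite loc_form2_sum//; apply: eq_bigr => j _; rewrite mulrC derive_mx ?mxE//.
  by apply/derivable_mxP => r k; rewrite ord1.
etransitivity; first exact: (D (loc_vfield X i) dX).
by rewrite [RHS](congr2 +%R frozen moving) big_split.
Qed.

Lemma near_eq_derive_chart i (f g : 'rV[R]_m -> R) p u : chart_dom i p ->
  (forall y, chart_im i y -> f y = g y) -> 'D_u f (chart i p) = 'D_u g (chart i p).
Proof.
move=> ip fg; apply: near_eq_derive; near=> y; apply: fg.
by near: y; exact: near_chart_im.
Unshelve. all: by end_near. Qed.

Lemma ext_deriv_form1 (a : covfield M) p (u v : 'rV[R]_m) :
  let c := chart_at p in
  ext_deriv (form1 a) p (col_mx u v) =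
  'D_u (fun y => loc_form (form1 a) c y v) (chart c p) -
  'D_v (fun y => loc_form (form1 a) c y u) (chart c p).
Proof.
rewrite /ext_deriv big_ord_recl big_ord1 expr0 mul1r expr1 mulN1r.
rewrite (_ : lift _ _ = 1 :> 'I_2); last exact/val_inj.
by rewrite row_col_mx0 row_col_mx1 row'_col_mx0 row'_col_mx1.
Qed.

Lemma lie_deriv_form2 X (w : kform M 2) p (u v : 'rV[R]_m) :
  let c := chart_at p in let x := chart c p in
  lie_deriv X w p (col_mx u v) =
  'D_(X p) (fun y => loc_form w c y (col_mx u v)) x +
  (w p (col_mx ('D_u (loc_vfield X c) x) v) +
   w p (col_mx u ('D_v (loc_vfield X c) x))).
Proof.
rewrite /lie_deriv; congr (_ + _).
rewrite big_ord_recl big_ord1 (_ : lift _ _ = 1 :> 'I_2); last exact/val_inj.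
by rewrite row_col_mx0 row_col_mx1 replace_row_col_mx0 replace_row_col_mx1.
Qed.

Lemma ext_deriv_form2 (w : kform M 2) p (t u v : 'rV[R]_m) :
  let c := chart_at p in let x := chart c p in
  ext_deriv w p (col_mx t (col_mx u v) : 'M[R]_(1 + 2, m)) =
  'D_t (fun y => loc_form w c y (col_mx u v)) x -
  'D_u (fun y => loc_form w c y (col_mx t v)) x +
  'D_v (fun y => loc_form w c y (col_mx t u)) x.
Proof.
pose A : 'M[R]_(3, m) := col_mx t (col_mx u v : 'M[R]_(1 + 1, m)).
have rowE (i : 'I_(1 + (1 + 1))) :
    row i (col_mx t (col_mx u v)) = nth 0 [:: t; u; v] i.
  case: (split_ordP i) => j ->; first by rewrite rowKu ord1 row_id.
  rewrite rowKd; case: (split_ordP j) => k ->.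
    by rewrite rowKu ord1 row_id.
  by rewrite rowKd ord1 row_id.
have rA (i : 'I_3) : row i A = nth 0 [:: t; u; v] i by exact: rowE.
have r'A (i : 'I_3) : row' i A =
    col_mx (nth 0 [:: t; u; v] (bump i 0)) (nth 0 [:: t; u; v] (bump i 1)).
  have rlift k : row k (row' i A) = row (lift i k) A by exact: row_row'.
  by rewrite -[LHS]col_mx_rows !rlift !rA.
rewrite /= /ext_deriv -/A !big_ord_recl big_ord0 !rA !r'A /=.
by rewrite expr0 expr1 mul1r addr0 mulN1r addrA sqrrN expr1n mul1r.
Qed.

(** Cartan's formula [L_X w = d (i_X w) + i_X (d w)] with [d w = 0]. In the
chart at [p], the Leibniz rule splits [d (i_X w)] into terms that differentiate
[X], which are those of the Lie derivative, and terms that differentiate [w] in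
the directions of the arguments; closedness of [w], evaluated on the value of [X]
and the two arguments, converts the latter into the derivative of [w] along
[X]. *)
Lemma ext_deriv_interior_product (w : kform M 2) X :
  smooth_form w -> smooth_vfield X ->
  (forall p v, ext_deriv w p v = 0) ->
  forall p v, ext_deriv (form1 (interior_product X w)) p v = lie_deriv X w p v.
Proof.
move=> sw sX dw p A; have [wml walt _] := sw.
rewrite -(col_mx_rows A); set u := row 0 A; set v := row 1 A.
have pc := chart_at_dom p.
have contraction (x y : 'rV[R]_m) :
    'D_x (fun z => loc_form (form1 (interior_product X w)) (chart_at p) z y)
      (chart (chart_at p) p) =
    'D_x (fun z => loc_form w (chart_at p) z (col_mx (X p) y))
      (chart (chart_at p) p) +
    w p (col_mx ('D_x (loc_vfield X (chart_at p)) (chart (chart_at p) p)) y).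
  rewrite -(loc_form_chart_at w) -[in RHS](loc_vfield_chart_at X p).
  rewrite -derive_loc_form2//; last exact: chart_im_chart.
  by apply: near_eq_derive_chart => // z iz; rewrite loc_interior_product.
rewrite ext_deriv_form1 !contraction lie_deriv_form2.
rewrite [in RHS](form2_anti (wml p) (walt p)) /=.
have := dw p (col_mx (X p) (col_mx u v)); rewrite ext_deriv_form2.
move=> /eqP; rewrite addr_eq0 subr_eq => /eqP ->; ring.
Qed.

End local_expressions.

(** * Infinitesimal symmetries of the 2-form *)

Theorem theorem2p5 (R : realType) (n : nat) (M : manifold R (2 * n + 1))
    (omega : covfield M) (Omega : kform M 2) (E : vfield M) (L : bivfield M)
    (hreg : regular_acc n omega Omega)
    (hdual : dual_pair omega Omega E L)
    (X : vfield M) (hX : smooth_vfield X) :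
  (forall p v, lie_deriv X Omega p v = 0) <->
  exists (h : M -> R) (alpha : covfield M),
    [/\ smooth_fun h,
        smooth_1form alpha,
        forall p, X p = Xfield E L alpha h p,
        forall p v, ext_deriv (form1 alpha) p v = 0 &
        forall p, pairing (alpha p) (E p) = 0].
Proof.
have [so sO dO nz] := hreg; have [Oml Oalt _] := sO.
have [_ [_ _ _ OE _]] := hdual.
have ker0 p u : flat Omega p u = 0 -> pairing (omega p) u = 0 -> u = 0.
  by apply: (regular_ker_trivial (Oml p) (Oalt p) (nz p)); rewrite mulnC addnC.
have cartan := ext_deriv_interior_product sO hX dO.
split=> [LX0|[h [alpha [_ _ XE dalpha alphaE]]]].
  exists (fun p => pairing (omega p) (X p)), (interior_product X Omega).
  split.
  - exact: smooth_pairing.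
  - exact: smooth_interior_product.
  - by move=> p; exact: (dual_pair_decomp ker0 sO hdual).
  - by move=> p v; rewrite cartan.
  - by move=> p; rewrite /interior_product flat_anti// OE /pairing mulmx0 mxE oppr0.
(* alpha is recovered from X, so that the Cartan formula applies to it *)
suff aE : interior_product X Omega = alpha by move=> p v; rewrite -cartan aE.
apply/funext => p; rewrite /interior_product XE /Xfield.
rewrite -[X in X + _]scale1r flat_linear// OE scaler0 addr0 scale1r.
exact: (flat_sharp_annihilator ker0 sO hdual).
Qed.
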